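(* For every integer $N\geq1$, $$d_2(N)=\tau(N),$$ where $\tau(N)$ is the number of positive divisors of $N$. For every prime $p$ and $r\geq1$, and every integer $N\geq1$, $$d_3(p^r)=p^{r-1}\bigl((r+1)p+r\bigr),\qquad d_3(N)=\prod_{p^r\parallel N}p^{r-1}\bigl((r+1)p+r\bigr),$$ the product being over the prime powers $p^r$ ($r\geq1$) exactly dividing $N$. In particular, $d_3(2)=5$, $d_3(4)=16$, $d_3(8)=44$, $d_3(9)=33$.
   Context: For $N\geq1$ let $A=\mathbb{Z}/N\mathbb{Z}$, $\widehat{A}=\mathrm{Hom}(A,U(1))$, $\mathcal{H}=\mathbb{C}[A]$ with orthonormal basis $|b\rangle$, $b\in A$; for $(a,\chi)\in A\oplus\widehat{A}$ let $W_{(a,\chi)}|b\rangle=\chi(b)|a+b\rangle$. Let $H(A)=\{zW_v:z\in U(1),v\in A\oplus\widehat{A}\}$ and $C(A)=N_{U(\mathcal{H})}(H(A))/(U(1)\cdot I)$ the projective Clifford group; for $g\in C(A)$ let $U_g$ be any unitary representative of $g$. For $t\geq1$, $$\mathfrak{D}_t(A)=\{X\in\mathrm{End}_{\mathbb{C}}(\mathcal{H}^{\otimes t}):XU_g^{\otimes t}=U_g^{\otimes t}X\text{ for every }g\in C(A)\}$$ (independent of the choice of representatives), and $d_t(N)=\dim\mathfrak{D}_t(\mathbb{Z}/N\mathbb{Z})$. *)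

(* Defs.v *)
From HB Require Import structures.
From mathcomp Require Import all_boot all_order all_algebra.
From mathcomp Require Import boolp classical_sets reals.
From mathcomp Require Import complex mxtens.

Set Implicit Arguments.
Unset Strict Implicit.
Unset Printing Implicit Defensive.

Import Order.TTheory GRing.Theory Num.Theory.
Local Open Scope classical_set_scope.
Local Open Scope ring_scope.

(* The additive group Z/NZ, for N >= 1. Unlike 'Z_N, it is trivial at N = 1. *)
Notation Zmod N := ('I_(N.-1.+1)).

Lemma vspace_of_subspace (K : fieldType) (vT : vectType K) (S : set vT) :
    S 0 -> (forall a u v, S u -> S v -> S (a *: u + v)) ->
  exists V : {vspace vT}, forall v, v \in V <-> S v.
Proof.
move=> S0 SD.
pose Q k := `[< exists V : {vspace vT}, \dim V = k /\ forall v, v \in V -> S v >].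
have exQ : exists k, Q k.
  exists 0%N; apply/asboolP; exists 0%VS; split; first by rewrite dimv0.
  by move=> v; rewrite memv0 => /eqP ->.
have bndQ k : Q k -> (k <= \dim {:vT})%N.
  by move=> /asboolP[V [<- _]]; apply: dimvS; apply: subvf.
case: (ex_maxnP exQ bndQ) => k /asboolP[V [dimV VS]] maxV.
exists V => v; split; first exact: VS.
move=> Sv; apply: contrapT => /negP nVv.
have /maxV : Q (\dim (V + <[v]>)%VS).
  apply/asboolP; exists (V + <[v]>)%VS; split=> // w.
  case/memv_addP=> x /VS Sx [_ /vlineP[a ->] ->].
  by rewrite addrC; apply: SD.
rewrite -dimV leqNgt => /negP; apply.
have sub : (V <= V + <[v]>)%VS by exact: addvSl.
rewrite ltn_neqAle dimvS // andbT; apply/negP => eqd.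
have /eqP eqV : V == (V + <[v]>)%VS by rewrite eqEdim sub (eqP eqd) leqnn.
by move/negP: nVv; apply; rewrite eqV (subvP (addvSr _ _)) ?memv_line.
Qed.

Section Clifford.
Variables (R : realType) (N : nat).

Definition unitChar (chi : Zmod N -> R[i]) : Prop :=
  (forall b, `|chi b| = 1) /\ {morph chi : a b / a + b >-> a * b}.

(* Operators on C[A] are written as matrices in the basis |b>, acting on
   column vectors: W_(a,chi) |b> = chi(b) |a + b>. *)
Definition weyl (a : Zmod N) (chi : Zmod N -> R[i]) : 'M[R[i]]_(N.-1.+1) :=
  \matrix_(i, b) (if i == a + b then chi b else 0).

Definition heisenberg : set 'M[R[i]]_(N.-1.+1) :=
  [set M | exists z a chi,
     [/\ `|z| = 1, unitChar chi & M = z *: weyl a chi]].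

Definition cliffordNormalizer : set 'M[R[i]]_(N.-1.+1) :=
  [set U | U \is unitarymx /\
     [set U *m h *m invmx U | h in heisenberg] = heisenberg].

Definition phaseClass (U : 'M[R[i]]_(N.-1.+1)) : set 'M[R[i]]_(N.-1.+1) :=
  [set z *: U | z in [set z : R[i] | `|z| = 1]].

(* The quotient of the normalizer by U(1): an element is a class {z U}, whose
   members are its unitary representatives. *)
Definition projClifford : set (set 'M[R[i]]_(N.-1.+1)) :=
  [set phaseClass U | U in cliffordNormalizer].

Definition commutes_with_Clifford (t : nat)
    (X : 'M[R[i]]_((N.-1.+1) ^ t)) : Prop :=
  forall g, projClifford g -> forall U, g U ->
    X *m ntensmx U t = ntensmx U t *m X.

Lemma commutant_exists t : exists V : {vspace 'M[R[i]]_((N.-1.+1) ^ t)},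
  forall X, X \in V <-> commutes_with_Clifford X.
Proof.
apply: (vspace_of_subspace (S := @commutes_with_Clifford t)).
  by move=> g _ U _; rewrite mul0mx mulmx0.
move=> a X Y hX hY g hg U gU.
by rewrite mulmxDl mulmxDr -scalemxAl -scalemxAr (hX g) // (hY g).
Qed.

Definition commutant t : {vspace 'M[R[i]]_((N.-1.+1) ^ t)} :=
  projT1 (cid (commutant_exists t)).

Lemma mem_commutant t X : X \in commutant t <-> commutes_with_Clifford X.
Proof. exact: (projT2 (cid (commutant_exists t))). Qed.

End Clifford.

Definition dimCommutant (R : realType) (t N : nat) : nat := \dim (commutant R N t).

(* Main.v *)
Require Import Defs.
From mathcomp Require Import all_boot all_order all_algebra.
From mathcomp Require Import all_solvable all_field.
From mathcomp Require Import boolp classical_sets reals.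
From mathcomp Require Import complex mxtens.
From mathcomp Require Import ring zify.

Set Implicit Arguments.
Unset Strict Implicit.
Unset Printing Implicit Defensive.

Import Order.TTheory GRing.Theory Num.Theory.
Local Open Scope ring_scope.

(** Write A = Z/N and W_v, v in A^2, for the Weyl operators
    |b> |-> zeta^(v_2 b) |v_1 + b>, a basis of End(C[A]).  Multiplication of
    Weyl operators adds their indices up to a phase, and a Clifford unitary U
    sends W_v to a phase times W_(g v).  The map g is additive because products
    go to products, and lies in SL2(A) because commutators go to commutators
    (covariant_implements).  Conversely each g in SL2(A) comes from a Clifford
    unitary (SL2_implemented): the Fourier transform gives the quarter turn,
    the diagonal chirps eta^(t b (b + N)), with eta^2 = zeta, give the shears,
    and the Euclidean algorithm writes every element of SL2(A) as a word in
    these (SL2_lift).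

    For t = k + 1 the algebra End(C[A]^(tensor t)) has the basis
        ((W_(v_1) ... W_(v_k))^-1 W_s) tensor W_(v_1) ... tensor W_(v_k),
    up to the order of the last k tensor factors.  Conjugation by the t-th
    tensor power of W_u multiplies such an element by the value of a character
    at s, and these characters separate every s <> 0 from 0, so an invariant
    operator only involves s = 0.  On the elements with s = 0 the phases of a
    Clifford unitary cancel, and it acts by the permutation
    (v_i) |-> (g v_i).  Hence d_t(N) is the number of orbits of SL2(A) on
    (A^2)^(t-1) (dim_tensor_commutant).

    Orbits on A^2.  By the Euclidean algorithm (x, y) is equivalent to
    (gcd(x, y, N), 0), so the orbits are the divisors of N.

    Orbits on pairs.  The Chinese remainder theorem reduces the count to a prime
    power (orbit_count_coprime).  Modulo p^(r+1) a pair (v, w) is of one of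
    three kinds (orbit_count_prime_power_step): p divides both, which leaves a
    pair modulo p^r; or v is nonzero modulo p and moves to (1, 0), whose
    stabiliser consists of the shears (x, y) |-> (x + t y, y), so that w
    contributes one orbit per y and per class x modulo gcd(y, p^(r+1)); or p
    divides v while w moves to (1, 0), and v / p contributes the same count
    modulo p^r.  With G_r the sum of gcd(y, p^r) over y modulo p^r, this reads
    d_3(p^(r+1)) = d_3(p^r) + G_(r+1) + G_r, and
    p G_r = (r + 1) p^(r+1) - r p^r gives the closed form. *)

(** * Two by two matrices and the Euclidean algorithm modulo N *)

(** Rows of a matrix as a pair of pairs, so that identities between entries are
    closed by ring. *)
Definition mx2 (K : Type) : Type := ((K * K) * (K * K))%type.

Section Mx2.
Variable K : comPzRingType.
Implicit Types (g h : mx2 K) (v w : K * K).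

Definition vact g v : K * K :=
  (g.1.1 * v.1 + g.1.2 * v.2, g.2.1 * v.1 + g.2.2 * v.2).
Definition mul2 g h : mx2 K :=
  ((g.1.1 * h.1.1 + g.1.2 * h.2.1, g.1.1 * h.1.2 + g.1.2 * h.2.2),
   (g.2.1 * h.1.1 + g.2.2 * h.2.1, g.2.1 * h.1.2 + g.2.2 * h.2.2)).
Definition det2 g : K := g.1.1 * g.2.2 - g.1.2 * g.2.1.
Definition adj2 g : mx2 K := ((g.2.2, - g.1.2), (- g.2.1, g.1.1)).
Definition one2 : mx2 K := ((1, 0), (0, 1)).
Definition rot2 : mx2 K := ((0, - 1), (1, 0)).
Definition shear2 (t : K) : mx2 K := ((1, 0), (t, 1)).

Lemma vact1 v : vact one2 v = v.
Proof. by case: v => x y; rewrite /vact /=; congr pair; ring. Qed.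

Lemma vact_mul g h v : vact (mul2 g h) v = vact g (vact h v).
Proof. by rewrite /vact /=; congr pair; ring. Qed.

Lemma det2_mul g h : det2 (mul2 g h) = det2 g * det2 h.
Proof. by rewrite /det2 /=; ring. Qed.

Lemma det2_adj g : det2 (adj2 g) = det2 g.
Proof. by rewrite /det2 /=; ring. Qed.

Lemma vact_adjK g v : vact (adj2 g) (vact g v) = (det2 g * v.1, det2 g * v.2).
Proof. by rewrite /vact /det2 /=; congr pair; ring. Qed.

Lemma vact_Kadj g v : vact g (vact (adj2 g) v) = (det2 g * v.1, det2 g * v.2).
Proof. by rewrite /vact /det2 /=; congr pair; ring. Qed.

End Mx2.

Definition vcong (N : int) (v w : int * int) : bool :=
  (N %| v.1 - w.1)%Z && (N %| v.2 - w.2)%Z.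

Lemma vcongxx N v : vcong N v v.
Proof. by rewrite /vcong !subrr dvdz0. Qed.

Lemma vcong_sym N v w : vcong N v w -> vcong N w v.
Proof. by case/andP=> E1 E2; rewrite /vcong -opprB rpredN E1 -opprB rpredN. Qed.

Lemma vcong_trans N u v w : vcong N u v -> vcong N v w -> vcong N u w.
Proof.
case/andP=> E1 E2 /andP[F1 F2]; apply/andP; split.
  by rewrite -(subrK v.1 u.1) -addrA rpredD.
by rewrite -(subrK v.2 u.2) -addrA rpredD.
Qed.

Lemma vcong_dvd M N v w : (M %| N)%Z -> vcong N v w -> vcong M v w.
Proof. by move=> MN /andP[E1 E2]; rewrite /vcong !(dvdz_trans MN). Qed.

Lemma vcong_vact N g v w : vcong N v w -> vcong N (vact g v) (vact g w).
Proof.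
case/andP=> E1 E2; apply/andP; split=> /=.
  rewrite (_ : _ - _ = g.1.1 * (v.1 - w.1) + g.1.2 * (v.2 - w.2)); last by ring.
  by rewrite rpredD // dvdz_mull.
rewrite (_ : _ - _ = g.2.1 * (v.1 - w.1) + g.2.2 * (v.2 - w.2)); last by ring.
by rewrite rpredD // dvdz_mull.
Qed.

(** P is any set of integer matrices of determinant 1 that is closed under products
    and contains the quarter turn and the lower shears.  Running the Euclidean
    algorithm backwards, from the gcd to the given column, needs no inverses. *)
Section Euclid.
Variable P : mx2 int -> Prop.
Hypothesis P_mul : forall g h, P g -> P h -> P (mul2 g h).
Hypothesis P_rot : P (rot2 _).
Hypothesis P_det : forall g, P g -> det2 g = 1.
Hypothesis P_shear : forall t, P (shear2 t).

Lemma euclid_column (a c : int) :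
  exists2 g, P g & vact g ((gcdn `|a| `|c|)%:Z, 0) = (a, c).
Proof.
have [n] := ubnP `|a|%N; elim: n a c => // n IHn a c ltan.
have [->|a0] := eqVneq a 0.
  rewrite gcd0n; case: (leP 0 c) => c0.
    by exists (rot2 _) => //; rewrite /vact /=; congr pair; lia.
  exists (mul2 (rot2 _) (mul2 (rot2 _) (rot2 _))); first by do !apply: P_mul.
  by rewrite /vact /=; congr pair; lia.
(* (a, c) is the shear by c / a of (a, c mod a), which is the quarter turn of
   (c mod a, - a). *)
have [|g Pg Eg] := IHn (c %% a)%Z (- a); first by lia.
exists (mul2 (shear2 (c %/ a)%Z) (mul2 (rot2 _) g)); first by do !apply: P_mul.
have -> : gcdn `|a| `|c| = gcdn `|(c %% a)%Z| `|- a|.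
  have := gcdz_modr a c; rewrite /gcdz => -[<-].
  by rewrite gcdnC abszN.
rewrite !vact_mul Eg /vact /=; congr pair; first by ring.
by rewrite [RHS](divz_eq c a); ring.
Qed.

(** Modulo N the column (h, 0), h = gcd(x, y), may be replaced by (h, N), and a
    second run of the Euclidean algorithm brings N into the gcd. *)
Lemma column_mod (N : nat) (v : int * int) :
  exists2 g, P g & vcong N (vact g ((gcdn (gcdn `|v.1| `|v.2|) N)%:Z, 0)) v.
Proof.
have [g Pg Eg] := euclid_column v.1 v.2.
have [h Ph Eh] := euclid_column (gcdn `|v.1| `|v.2|)%:Z N%:Z.
exists (mul2 g h); first exact: P_mul.
move: Eh; rewrite vact_mul !absz_nat => ->.
have Ev : v = vact g ((gcdn `|v.1| `|v.2|)%:Z, 0) by rewrite Eg; case: (v).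
rewrite [X in vcong _ _ X]Ev.
by apply: vcong_vact; rewrite /vcong /= subrr subr0 dvdz0 dvdzz.
Qed.

Lemma generated_upper t : P ((1, t), (0, 1)).
Proof.
have -> : ((1, t), (0, 1)) = mul2 (rot2 _) (mul2 (shear2 (- t))
            (mul2 (rot2 _) (mul2 (rot2 _) (rot2 _)))) :> mx2 int.
  by rewrite /mul2 /=; congr pair; congr pair; ring.
by do !apply: P_mul.
Qed.

(** P surjects onto SL2(Z/N).  The first column of g is unimodular, hence
    congruent to the first column of some h in P; then h^-1 g fixes (1, 0)
    modulo N and is congruent to an upper shear. *)
Lemma SL2_lift (N : nat) g : (N %| det2 g - 1)%Z ->
  exists2 h, P h & forall v, vcong N (vact h v) (vact g v).
Proof.
move=> Dg.
have cop : gcdn (gcdn `|g.1.1| `|g.2.1|) N = 1%N.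
  apply/eqP; rewrite -dvdn1; set d := gcdn _ _.
  have d11 : (d%:Z %| g.1.1)%Z by rewrite dvdzE /= (dvdn_trans (dvdn_gcdl _ _)) ?dvdn_gcdl.
  have d21 : (d%:Z %| g.2.1)%Z by rewrite dvdzE /= (dvdn_trans (dvdn_gcdl _ _)) ?dvdn_gcdr.
  have dN : (d%:Z %| det2 g - 1)%Z by apply: dvdz_trans Dg; rewrite dvdzE /= dvdn_gcdr.
  suff: (d%:Z %| 1%R)%Z by [].
  have -> : 1 = g.2.2 * g.1.1 + - g.1.2 * g.2.1 - (det2 g - 1) by rewrite /det2; ring.
  by rewrite rpredB // rpredD // dvdz_mull.
have [h Ph] := column_mod N (g.1.1, g.2.1).
rewrite cop /vcong /vact /= !mulr1 !mulr0 !addr0 => /andP[E1 E2].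
have Dh := P_det Ph.
(* The upper right entry of h^-1 g. *)
pose t := h.2.2 * g.1.2 - h.1.2 * g.2.2.
exists (mul2 h ((1, t), (0, 1))) => [|v]; first exact/P_mul/generated_upper.
apply/andP; split=> /=; move: Dh Dg; rewrite /t /det2 => Dh Dg.
  rewrite (_ : _ - _ = (v.1 - h.1.2 * g.2.2 * v.2) * (h.1.1 - g.1.1)
      + h.1.2 * g.1.2 * v.2 * (h.2.1 - g.2.1)
      - h.1.2 * v.2 * (g.1.1 * g.2.2 - g.1.2 * g.2.1 - 1)
      + g.1.2 * v.2 * (h.1.1 * h.2.2 - h.1.2 * h.2.1 - 1)); last by ring.
  by rewrite Dh subrr mulr0 addr0 rpredB ?rpredD // dvdz_mull.
rewrite (_ : _ - _ = (v.1 + h.2.2 * g.1.2 * v.2) * (h.2.1 - g.2.1)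
    - h.2.2 * g.2.2 * v.2 * (h.1.1 - g.1.1)
    - h.2.2 * v.2 * (g.1.1 * g.2.2 - g.1.2 * g.2.1 - 1)
    + g.2.2 * v.2 * (h.1.1 * h.2.2 - h.1.2 * h.2.1 - 1)); last by ring.
by rewrite Dh subrr mulr0 addr0 rpredB ?rpredB // dvdz_mull.
Qed.

End Euclid.

(** * Orbits of SL2 modulo N on families of vectors *)

Definition complete_reps (T : Type) (e : T -> T -> Prop) (I : Type) (f : I -> T) :=
  (forall i j, e (f i) (f j) -> i = j) /\ (forall x, exists i, e (f i) x).

(** K is unit for single vectors and bool for pairs.  Vectors are kept as integer
    vectors up to congruence, which lets the modulus vary. *)
Section OrbitRelation.
Variable K : Type.
Implicit Types x y z : K -> int * int.

Definition same_orbit (N : int) x y :=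
  exists2 g : mx2 int, (N %| det2 g - 1)%Z & forall k, vcong N (vact g (x k)) (y k).

Lemma same_orbit_cong N x y : (forall k, vcong N (x k) (y k)) -> same_orbit N x y.
Proof.
move=> xy; exists (one2 _); first by rewrite /det2 /= mulr1 mulr0 subr0 subrr dvdz0.
by move=> k; rewrite vact1.
Qed.

Lemma same_orbit_trans N y x z :
  same_orbit N x y -> same_orbit N y z -> same_orbit N x z.
Proof.
case=> g Dg gx [h Dh hy]; exists (mul2 h g).
  rewrite det2_mul (_ : _ - 1 = (det2 h) * (det2 g - 1) + (det2 h - 1)); last by ring.
  by rewrite rpredD // dvdz_mull.
by move=> k; rewrite vact_mul; apply: vcong_trans (hy k); apply: vcong_vact.
Qed.

(** The adjugate inverts g up to the scalar det g, which is 1 modulo N. *)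
Lemma same_orbit_sym N x y : same_orbit N x y -> same_orbit N y x.
Proof.
case=> g Dg gx; exists (adj2 g); first by rewrite det2_adj.
move=> k; apply: vcong_trans (vcong_vact (adj2 g) (vcong_sym (gx k))) _.
rewrite vact_adjK /vcong /=.
by rewrite -{2}[(x k).1]mul1r -{2}[(x k).2]mul1r -!mulrBl !dvdz_mulr.
Qed.

Lemma same_orbit_dvd M N x y : (M %| N)%Z -> same_orbit N x y -> same_orbit M x y.
Proof.
move=> MN [g Dg gx]; exists g; first exact: dvdz_trans Dg.
by move=> k; apply: vcong_dvd (gx k).
Qed.

Definition vchinese (m n : nat) (v w : int * int) : int * int :=
  (zchinese m n v.1 w.1, zchinese m n v.2 w.2).

Lemma vchinese_l (m n : nat) v w : coprime m n -> vcong m (vchinese m n v w) v.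
Proof.
move=> cop; have cz : coprimez m n by rewrite coprimezE.
by rewrite /vcong /= -!eqz_mod_dvd !zchinese_modl // !eqxx.
Qed.

Lemma vchinese_r (m n : nat) v w : coprime m n -> vcong n (vchinese m n v w) w.
Proof.
move=> cop; have cz : coprimez m n by rewrite coprimezE.
by rewrite /vcong /= -!eqz_mod_dvd !zchinese_modr // !eqxx.
Qed.

Lemma dvdz_coprime (m n : nat) (a : int) : coprime m n ->
  (m%:Z %| a)%Z -> (n%:Z %| a)%Z -> ((m * n)%N %| a)%Z.
Proof. by move=> cop; rewrite !dvdzE /= => ma na; rewrite Gauss_dvd ?ma. Qed.

Lemma vcong_coprime (m n : nat) v w : coprime m n ->
  vcong m v w -> vcong n v w -> vcong (m * n)%N v w.
Proof.
by move=> cop /andP[m1 m2] /andP[n1 n2]; rewrite /vcong !dvdz_coprime.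
Qed.

(** SL2(Z/mn) is the product of SL2(Z/m) and SL2(Z/n): two matrices are glued
    entry by entry, and the determinant is then 1 modulo both m and n. *)
Lemma same_orbit_coprime (m n : nat) x y : coprime m n ->
  same_orbit m x y -> same_orbit n x y -> same_orbit (m * n)%N x y.
Proof.
move=> cop [g Dg gx] [h Dh hx].
pose k : mx2 int := (vchinese m n g.1 h.1, vchinese m n g.2 h.2).
have act_entries (q : nat) (g' : mx2 int) v :
    vcong q k.1 g'.1 -> vcong q k.2 g'.2 -> vcong q (vact k v) (vact g' v).
  move=> /andP[a1 a2] /andP[b1 b2]; apply/andP; split=> /=.
    rewrite (_ : _ - _ = v.1 * (k.1.1 - g'.1.1) + v.2 * (k.1.2 - g'.1.2)); last by ring.
    by rewrite rpredD // dvdz_mull.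
  rewrite (_ : _ - _ = v.1 * (k.2.1 - g'.2.1) + v.2 * (k.2.2 - g'.2.2)); last by ring.
  by rewrite rpredD // dvdz_mull.
have det_entries (q : nat) (g' : mx2 int) : (q %| det2 g' - 1)%Z ->
    vcong q k.1 g'.1 -> vcong q k.2 g'.2 -> (q %| det2 k - 1)%Z.
  move=> D /andP[a1 a2] /andP[b1 b2]; rewrite /det2 /=.
  rewrite (_ : _ - 1 = k.2.2 * (k.1.1 - g'.1.1) + g'.1.1 * (k.2.2 - g'.2.2)
     - k.2.1 * (k.1.2 - g'.1.2) - g'.1.2 * (k.2.1 - g'.2.1) + (det2 g' - 1)).
    by rewrite rpredD // !rpredB ?rpredD // dvdz_mull.
  by rewrite /det2; ring.
have [[l1 l2] [r1 r2]] := ((vchinese_l g.1 h.1 cop, vchinese_l g.2 h.2 cop),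
                             (vchinese_r g.1 h.1 cop, vchinese_r g.2 h.2 cop)).
exists k.
  by apply: dvdz_coprime; [|apply: (det_entries _ g)|apply: (det_entries _ h)].
move=> j; apply: vcong_coprime => //.
  by apply: vcong_trans (gx j); apply: act_entries.
by apply: vcong_trans (hx j); apply: act_entries.
Qed.

Definition orbit_count (N k : nat) :=
  exists (I : finType) (f : I -> K -> int * int),
    complete_reps (same_orbit N) f /\ #|I| = k.

Lemma orbit_count_coprime m n a b : coprime m n ->
  orbit_count m a -> orbit_count n b -> orbit_count (m * n) (a * b).
Proof.
move=> cop [I [f [[injf surjf] <-]]] [J [g [[injg surjg] <-]]].
pose h (ij : I * J) k := vchinese m n (f ij.1 k) (g ij.2 k).
have hf ij : same_orbit m (h ij) (f ij.1).
  by apply: same_orbit_cong => k; apply: vchinese_l.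
have hg ij : same_orbit n (h ij) (g ij.2).
  by apply: same_orbit_cong => k; apply: vchinese_r.
exists (I * J)%type, h; split; last exact: card_prod.
split=> [[i j] [i' j'] hij | x].
  congr pair.
    apply/injf/(same_orbit_trans (same_orbit_sym (hf (i, j)))).
    apply: same_orbit_trans (hf (i', j')).
    by apply: same_orbit_dvd hij; rewrite PoszM dvdz_mulr.
  apply/injg/(same_orbit_trans (same_orbit_sym (hg (i, j)))).
  apply: same_orbit_trans (hg (i', j')).
  by apply: same_orbit_dvd hij; rewrite PoszM dvdz_mull.
have [i fi] := surjf x; have [j gj] := surjg x.
exists (i, j); apply: same_orbit_coprime => //.
  exact: same_orbit_trans (hf (i, j)) fi.
exact: same_orbit_trans (hg (i, j)) gj.
Qed.

End OrbitRelation.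

(** * Counting the orbits on vectors and on pairs of vectors *)

Lemma SL2_column (N : nat) (v : int * int) :
  exists2 g, det2 g = 1 & vcong N (vact g ((gcdn (gcdn `|v.1| `|v.2|) N)%:Z, 0)) v.
Proof.
apply: column_mod => [g h Dg Dh||t]; try by rewrite /det2 /=; ring.
by rewrite det2_mul Dg Dh.
Qed.

Lemma SL2_lift_int (N : nat) g : (N %| det2 g - 1)%Z ->
  exists2 h, det2 h = 1 & forall v, vcong N (vact h v) (vact g v).
Proof.
apply: SL2_lift => [g' h Dg Dh||//|t]; try by rewrite /det2 /=; ring.
by rewrite det2_mul Dg Dh.
Qed.

Lemma same_orbit_content (K : Type) (d N : int) (x y : K -> int * int) k :
  (d %| N)%Z -> same_orbit N x y -> vcong d (x k) (0, 0) -> vcong d (y k) (0, 0).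
Proof.
move=> dN [g _ gx] x0; apply: vcong_trans (vcong_sym (vcong_dvd dN (gx k))) _.
apply: vcong_trans (vcong_vact g x0) _.
by rewrite /vact /= !mulr0 addr0 vcongxx.
Qed.

(** The vectors (d, 0), d a divisor of N, represent the orbits: gcd(x, y, N) is
    an invariant, and SL2_column moves every vector to one of them. *)
Lemma orbit_count_vectors N : (0 < N)%N -> orbit_count unit N (size (divisors N)).
Proof.
move=> N0; pose dv i : int := (nth 0%N (divisors N) i)%:Z.
exists 'I_(size (divisors N)), (fun (i : 'I__) _ => (dv i, 0)); split; last exact: card_ord.
have dvN (i : 'I_(size (divisors N))) : (dv i %| N%:Z)%Z.
  by rewrite dvdzE /= dvdn_divisors // mem_nth.
have le_orbit (i j : 'I_(size (divisors N))) :
    same_orbit N (fun _ : unit => (dv i, 0)) (fun _ => (dv j, 0)) ->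
    (nth 0 (divisors N) i %| nth 0 (divisors N) j)%N.
  move=> /(same_orbit_content (k := tt) (dvN i)).
  by rewrite /vcong /= !subr0 dvdzz dvdz0 => /(_ isT) /andP[].
split=> [i j ij | x].
  apply/val_inj/eqP.
  rewrite -(nth_uniq 0%N (ltn_ord i) (ltn_ord j) (divisors_uniq N)) eqn_dvd.
  by rewrite !le_orbit //; apply: same_orbit_sym.
have [g Dg gx] := SL2_column N (x tt).
set d := gcdn _ N in gx.
have dd : d \in divisors N by rewrite -dvdn_divisors // dvdn_gcdr.
have ltd : (index d (divisors N) < size (divisors N))%N by rewrite index_mem.
exists (Ordinal ltd), g; first by rewrite Dg subrr dvdz0.
by case; rewrite /dv /= nth_index.
Qed.

(** The stabiliser of (1, 0) in SL2(Z/M) consists of the upper shears, and the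
    orbit of (x, y) under them is determined by y and by x modulo gcd(y, M). *)
Section ShearNormalForm.
Variable M : nat.

Definition shear_nf : finType := {y : 'I_M & 'I_(gcdn y M)}.
Definition nfvec (u : shear_nf) : int * int := ((tagged u : nat)%:Z, (tag u : nat)%:Z).

Lemma card_shear_nf : #|shear_nf| = (\sum_(y < M) gcdn y M)%N.
Proof.
rewrite card_tagged sumnE big_map big_enum /=.
by apply: eq_bigr => y _; rewrite card_ord.
Qed.

Lemma shear_nf_exists (v : int * int) : (0 < M)%N ->
  exists u t, vcong M (vact ((1, t), (0, 1)) v) (nfvec u).
Proof.
move=> M0.
have ymod : ((v.2 %% M)%Z = `|(v.2 %% M)%Z|%N%:Z) by rewrite gez0_abs ?modz_ge0 -?lt0n.
have lty : (`|(v.2 %% M)%Z| < M)%N by rewrite -ltz_nat -ymod ltz_pmod.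
pose y := Ordinal lty; pose d := gcdn y M.
have d0 : (0 < d)%N by rewrite gcdn_gt0 M0 orbT.
have xmod : ((v.1 %% d)%Z = `|(v.1 %% d)%Z|%N%:Z) by rewrite gez0_abs ?modz_ge0 -?lt0n.
have ltx : (`|(v.1 %% d)%Z| < d)%N by rewrite -ltz_nat -xmod ltz_pmod.
have [a [b ab]] := Bezoutz (v.2 %% M)%Z M.
exists (Tagged (fun y : 'I_M => 'I_(gcdn y M)) (Ordinal ltx : 'I_(gcdn y M))).
(* By Bezout a * y = d modulo M, so this shear subtracts (v.1 / d) * d from v.1. *)
exists (- (v.1 %/ d)%Z * a); rewrite /nfvec /vcong /= -xmod -ymod.
have dE : gcdz (v.2 %% M)%Z M = d by rewrite /d /gcdz.
move: ab; rewrite dE => ab.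
have E1 := divz_eq v.1 d; have E2 := divz_eq v.2 M.
set q := (v.1 %/ d)%Z in E1 *; set s := (v.2 %/ M)%Z in E2 *.
set xx := (v.1 %% d)%Z in E1 *; set yy := (v.2 %% M)%Z in E2 ab *.
rewrite E1 E2 -ab; apply/andP; split.
  by rewrite (_ : _ - _ = (q * b - q * a * s) * M); [rewrite dvdz_mull | ring].
by rewrite (_ : _ - _ = s * M); [rewrite dvdz_mull | ring].
Qed.

Lemma ord_cong_inj n (i j : 'I_n) : (n %| (i : nat)%:Z - (j : nat)%:Z)%Z -> i = j.
Proof.
rewrite -eqz_mod_dvd => /eqP; rewrite !modz_nat => -[].
by rewrite !modn_small // => /val_inj.
Qed.

Lemma shear_nf_inj g (u u' : shear_nf) : (M %| det2 g - 1)%Z ->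
  vcong M (vact g (1, 0)) (1, 0) -> vcong M (vact g (nfvec u)) (nfvec u') -> u = u'.
Proof.
case: u u' => [y x] [y' x'] Dg; rewrite /vact /vcong /nfvec /= !mulr1 !mulr0 !addr0.
case/andP=> a1 c0 /andP[E1 E2].
have d1 : (M %| g.2.2 - 1)%Z.
  have -> : g.2.2 - 1 = det2 g - 1 - (g.2.2 * (g.1.1 - 1) - g.1.2 * g.2.1).
    by rewrite /det2; ring.
  by rewrite rpredB // rpredB // dvdz_mull.
have yy' : y = y'.
  apply: ord_cong_inj.
  rewrite (_ : _ - _ = g.2.1 * x%:Z + g.2.2 * y%:Z - y'%:Z
    - (g.2.1 * x%:Z + (g.2.2 - 1) * y%:Z)); last by ring.
  by rewrite rpredB // rpredD // dvdz_mulr.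
subst y'; congr existT; apply: ord_cong_inj.
have dM : (gcdn y M %| M%:Z)%Z by rewrite dvdzE /= dvdn_gcdr.
have dy : (gcdn y M %| y%:Z)%Z by rewrite dvdzE /= dvdn_gcdl.
rewrite (_ : _ - _ = g.1.1 * x%:Z + g.1.2 * y%:Z - x'%:Z
  - ((g.1.1 - 1) * x%:Z + g.1.2 * y%:Z)); last by ring.
apply: rpredB; first exact: dvdz_trans dM E1.
apply: rpredD; last exact: dvdz_mull.
exact/dvdz_mulr/(dvdz_trans dM).
Qed.

End ShearNormalForm.

Definition vpair (v w : int * int) (b : bool) := if b then v else w.
Definition vscale (p : int) (v : int * int) : int * int := (p * v.1, p * v.2).

Lemma vact_scale p g v : vact g (vscale p v) = vscale p (vact g v).
Proof. by rewrite /vact /vscale /=; congr pair; ring. Qed.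

Lemma vcong_scale p N v w : p != 0 ->
  vcong (p * N) (vscale p v) (vscale p w) = vcong N v w.
Proof. by move=> p0; rewrite /vcong /= -!mulrBr !dvdz_mul2l. Qed.

Lemma vcong_scale0 p v : vcong p (vscale p v) (0, 0).
Proof. by rewrite /vcong /= !subr0 !dvdz_mulr. Qed.

Lemma vcong0P p v : vcong p v (0, 0) -> exists w, v = vscale p w.
Proof.
rewrite /vcong /= !subr0 => /andP[/dvdzP[a E] /dvdzP[b F]].
by exists (a, b); rewrite /vscale /= ![p * _]mulrC -E -F; case: (v).
Qed.

Lemma same_orbit_act (K : Type) (N : int) h (x : K -> int * int) :
  det2 h = 1 -> same_orbit N x (fun k => vact h (x k)).
Proof. by move=> Dh; exists h => [|k]; rewrite ?Dh ?subrr ?dvdz0 ?vcongxx. Qed.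

Lemma vact_upper1 (t : int) : vact ((1, t), (0, 1)) (1, 0) = (1, 0).
Proof. by rewrite /vact /=; congr pair; ring. Qed.

Section PrimePower.
Variables (p r : nat).
Hypothesis p_pr : prime p.
Let M := (p ^ r)%N.
Let N := (p ^ r.+1)%N.

Let NE : N%:Z = p%:Z * M%:Z. Proof. by rewrite -PoszM -expnS. Qed.
Let p0 : p%:Z != 0. Proof. by case: p p_pr. Qed.
Let M0 : (0 < M)%N. Proof. by rewrite expn_gt0 prime_gt0. Qed.
Let N0 : (0 < N)%N. Proof. by rewrite expn_gt0 prime_gt0. Qed.

(** A vector that is nonzero modulo p generates the unit ideal modulo p^(r+1), so
    it lies in the orbit of (1, 0). *)
Lemma unimodular_column (v : int * int) : ~~ vcong p v (0, 0) ->
  exists2 h, det2 h = 1 & vcong N (vact h v) (1, 0).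
Proof.
move=> pv; have [g Dg gv] := SL2_column N v.
exists (adj2 g); first by rewrite det2_adj.
suff d1 : gcdn (gcdn `|v.1| `|v.2|) N = 1%N.
  apply: vcong_trans (vcong_vact _ (vcong_sym gv)) _.
  by rewrite d1 vact_adjK Dg !mul1r vcongxx.
apply/eqP; rewrite -[_ == _]/(coprime _ _) coprimeXr // coprime_sym prime_coprime //.
by move: pv; rewrite /vcong /= !subr0 dvdn_gcd !dvdzE.
Qed.

(** The three summands are the pairs with both entries divisible by p, those
    whose first entry is nonzero modulo p, and those where only the second is. *)
Lemma orbit_count_prime_power_step a : orbit_count bool M a ->
  orbit_count bool N (a + \sum_(y < N) gcdn y N + \sum_(y < M) gcdn y M).
Proof.
case=> I [f [[injf surjf] <-]].
pose F (u : I + shear_nf N + shear_nf M) : bool -> int * int := match u with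
  | inl (inl i) => vscale p \o f i
  | inl (inr u) => vpair (1, 0) (nfvec u)
  | inr u => vpair (vscale p (nfvec u)) (1, 0)
  end.
exists (I + shear_nf N + shear_nf M)%type, F; split; last first.
  by rewrite !card_sum !card_shear_nf.
have pN : (p %| N%:Z)%Z by rewrite NE dvdz_mulr.
have p1 : vcong p (1, 0) (0, 0) = false.
  by rewrite /vcong /= subr0 dvdzE /= dvdn1; case: p p_pr => [|[]].
have content (x y : bool -> int * int) k :
    same_orbit N x y -> vcong p (x k) (0, 0) = vcong p (y k) (0, 0).
  move=> xy; apply/idP/idP; first exact: same_orbit_content pN xy.
  exact: same_orbit_content pN (same_orbit_sym xy).
(* Different kinds are separated by divisibility of the two entries by p. *)
split=> [u u' uu' | x].
  have ct := content _ _ true uu'; have cf := content _ _ false uu'.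
  have [g Dg guu'] := uu'.
  have MD : (M %| det2 g - 1)%Z by apply: dvdz_trans Dg; rewrite NE dvdz_mull.
  move: u u' uu' ct cf guu' => [[i|u]|u] [[i'|u']|u'] uu';
    rewrite /F /= ?p1 ?vcong_scale0 // => _ _ guu'.
  - do 2 congr inl; apply: injf; exists g => // k.
    by have := guu' k; rewrite vact_scale NE vcong_scale.
  - by congr (inl (inr _)); apply: shear_nf_inj Dg (guu' true) (guu' false).
  - congr inr; apply: (shear_nf_inj (g := g)) => //.
      by apply: vcong_dvd (guu' false); rewrite NE dvdz_mull.
    by have := guu' true; rewrite /= vact_scale NE vcong_scale.
have upper1 (t : int) : det2 ((1, t), (0, 1)) = 1 by rewrite /det2 /=; ring.
pose shear (t : int) (y : bool -> int * int) k := vact ((1, t), (0, 1)) (y k).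
have reach h t y : det2 h = 1 ->
    (forall k, vcong N (shear t (fun k => vact h (x k)) k) (y k)) -> same_orbit N y x.
  move=> Dh E; apply: same_orbit_sym.
  apply: same_orbit_trans (same_orbit_act _ _ Dh) _.
  apply: same_orbit_trans (same_orbit_act _ _ (upper1 t)) _.
  exact: same_orbit_cong.
case: (boolP (vcong p (x true) (0, 0))) => [/vcong0P[v xE] | xt]; last first.
  have [h Dh hx] := unimodular_column xt.
  have [u [t wu]] := shear_nf_exists (vact h (x false)) N0.
  exists (inl (inr u)); apply: (reach h t) => //; case=> //=.
  by rewrite -(vact_upper1 t); apply: vcong_vact.
case: (boolP (vcong p (x false) (0, 0))) => [/vcong0P[w xE'] | xf]; last first.
  have [h Dh hx] := unimodular_column xf.
  have [u [t wu]] := shear_nf_exists (vact h v) M0.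
  exists (inr u); apply: (reach h t) => //; case=> /=; last first.
    by rewrite -(vact_upper1 t); apply: vcong_vact.
  by rewrite /shear xE !vact_scale NE vcong_scale.
have [i [g Dg gf]] := surjf (vpair v w).
(* g has determinant 1 modulo p^r only; it is replaced by a congruent integer
   matrix h of determinant 1, which also acts modulo p^(r+1). *)
have [h Dh hg] := SL2_lift_int Dg.
exists (inl (inl i)), h; first by rewrite Dh subrr dvdz0.
move=> k; have -> : x k = vscale p (vpair v w k) by case: k.
by rewrite /= vact_scale NE vcong_scale //; apply: vcong_trans (hg _) (gf _).
Qed.

End PrimePower.

Lemma orbit_count_1 K : orbit_count K 1 1.
Proof.
exists 'I_1, (fun _ _ => (0, 0)); split; last exact: card_ord.
split=> [i j _ | x]; first by rewrite !ord1.
by exists ord0; apply: same_orbit_cong => k; rewrite /vcong !dvd1z.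
Qed.

(** Split y = p i + s: the terms with s = 0 give p gcd(i, p^r), and the other
    p - 1 terms of each block are 1. *)
Lemma sum_gcdn_prime_power_step p r : prime p ->
  (\sum_(y < p ^ r.+1) gcdn y (p ^ r.+1) + p ^ r =
   p * \sum_(y < p ^ r) gcdn y (p ^ r) + p ^ r.+1)%N.
Proof.
move=> p_pr; have p0 := prime_gt0 p_pr.
rewrite -(big_mkord xpredT (fun y => gcdn y (p ^ r.+1)%N)).
rewrite -(big_mkord xpredT (fun y => gcdn y (p ^ r)%N)).
rewrite {1}(expnSr p r) big_nat_mul.
transitivity (\sum_(0 <= i < p ^ r) (p * gcdn i (p ^ r) + p.-1) + p ^ r)%N; last first.
  rewrite big_split /= -big_distrr -addnA sum_nat_const_nat subn0 -mulnSr.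
  by rewrite prednK // -expnSr.
congr addn; apply: eq_bigr => i _; rewrite big_ltn ?ltn_pmul2r //.
congr addn; first by rewrite expnSr -muln_gcdl mulnC.
rewrite (eq_big_nat _ _ (F2 := fun=> 1%N)) => [|j /andP[lj uj]].
  by rewrite sum_nat_const_nat muln1 mulSn; lia.
apply/eqP; rewrite -[_ == _]/(coprime _ _) coprimeXr // coprime_sym prime_coprime //.
apply/negP => /dvdnP[k jE]; move: lj uj; rewrite jE !ltn_pmul2r // ltnS.
by move=> /leq_trans H /H; rewrite ltnn.
Qed.

Lemma sum_gcdn_prime_power p r : prime p ->
  (p * \sum_(y < p ^ r) gcdn y (p ^ r) + r * p ^ r = r.+1 * p ^ r.+1)%N.
Proof.
move=> p_pr; elim: r => [|r IHr]; first by rewrite big_ord1 gcdn1 mul0n addn0 mul1n muln1.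
have := sum_gcdn_prime_power_step r p_pr.
move: IHr; set G := (\sum_(y < _) _)%N; set G' := (\sum_(y < _) _)%N.
rewrite !expnS; set M := (p ^ r)%N => E E'.
have : (p * (G' + M) = p * (p * G + p * M))%N by rewrite E'.
by rewrite mulnDr; nia.
Qed.

Lemma orbit_count_prime_power p r : prime p -> (0 < r)%N ->
  orbit_count bool (p ^ r) (p ^ r.-1 * (r.+1 * p + r)).
Proof.
move=> p_pr r0; have p0 := prime_gt0 p_pr.
have [c cr] : exists2 c, orbit_count bool (p ^ r) c &
    (p * c = p ^ r * (r.+1 * p + r))%N.
  elim: r {r0} => [|r [c oc cE]].
    by exists 1%N; [exact: orbit_count_1 | rewrite muln1 !mul1n addn0].
  have := orbit_count_prime_power_step p_pr oc.
  have := sum_gcdn_prime_power r.+1 p_pr; have := sum_gcdn_prime_power r p_pr.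
  set G := (\sum_(y < _) _)%N; set G' := (\sum_(y < _) _)%N => GE GE' oc'.
  exists (c + G' + G)%N => //; move: GE GE' cE; rewrite !expnS.
  by set M := (p ^ r)%N; nia.
move=> cE; suff <- : c = (p ^ r.-1 * (r.+1 * p + r))%N by [].
apply/eqP; rewrite -(eqn_pmul2l p0) cE mulnA -expnS prednK //.
Qed.

Lemma orbit_count_pairs N : (0 < N)%N -> orbit_count bool N
  (\prod_(p <- primes N) (p ^ (logn p N).-1 * ((logn p N).+1 * p + logn p N))).
Proof.
move=> N0; rewrite {1}(prod_prime_decomp N0) prime_decompE big_map /=.
have pos q : q \in primes N -> (0 < logn q N)%N by rewrite logn_gt0.
have pr q : q \in primes N -> prime q by rewrite mem_primes => /andP[].
elim: (primes N) (primes_uniq N) pos pr => [|q s IHs] /=.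
  by rewrite !big_nil => _ _ _; apply: orbit_count_1.
move=> /andP[qs us] pos pr; rewrite !big_cons.
apply: orbit_count_coprime.
- rewrite coprime_sym big_seq; elim/big_ind: _ => //= [|x y|j js].
  + exact: coprime1n.
  + by rewrite coprimeMl => -> ->.
  + rewrite coprimeXl // coprimeXr // prime_coprime ?pr ?inE ?js ?orbT //.
    rewrite dvdn_prime2 ?pr ?inE ?js ?eqxx ?orbT //.
    by apply: contraNneq qs => <-.
- by apply: orbit_count_prime_power; [apply: pr|apply: pos]; rewrite mem_head.
- by apply: IHs => // q' q's; [apply: pos|apply: pr]; rewrite inE q's orbT.
Qed.

(** * The commutant of operators that permute a basis *)

Section Dimension.
Variables (K : fieldType) (vT : vectType K) (I : finType) (O : I -> vT).
Hypothesis freeO : forall c : I -> K, \sum_i c i *: O i = 0 -> forall i, c i = 0.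

Let b := [tuple O (enum_val i) | i < #|I|].

Let sum_b (c : 'I_#|I| -> K) :
  \sum_i c i *: b`_i = \sum_i c (enum_rank i) *: O i.
Proof.
rewrite (reindex (@enum_rank I)); last by apply: onW_bij; apply: enum_rank_bij.
apply: eq_bigr => i _; rewrite (nth_map (enum_rank i)) ?size_enum_ord //.
by rewrite nth_ord_enum enum_rankK.
Qed.

Let free_b : free b.
Proof.
apply/freeP => c; rewrite sum_b => /freeO c0 i.
by rewrite -(enum_valK i) c0.
Qed.

Lemma dim_free_param (V : {vspace vT}) :
  (forall v, v \in V <-> exists c, v = \sum_i c i *: O i) -> \dim V = #|I|.
Proof.
move=> VE; have -> : V = <<b>>%VS.
  apply/vspaceP => v; apply/idP/idP.
    case/VE=> c ->; apply: rpred_sum => i _; apply: rpredZ; apply: memv_span.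
    by apply/tnthP; exists (enum_rank i); rewrite tnth_mktuple enum_rankK.
  move=> /coord_span ->; apply/VE; rewrite sum_b.
  by eexists (fun i => _).
by rewrite (eqP free_b) size_tuple.
Qed.

Lemma free_span : #|I| = \dim {:vT} -> forall v, exists c, v = \sum_i c i *: O i.
Proof.
move=> cardI v; have /eqP full : <<b>>%VS == fullv.
  by rewrite eqEdim subvf (eqP free_b) size_tuple cardI leqnn.
have : v \in <<b>>%VS by rewrite full memvf.
by move=> /coord_span ->; rewrite sum_b; eexists (fun i => _).
Qed.

End Dimension.

Lemma mxtrace_tens (K : comPzRingType) m n (A : 'M[K]_m) (B : 'M[K]_n) :
  \tr (A *t B) = \tr A * \tr B.
Proof. by rewrite /mxtrace mulr_sum; apply: eq_bigr => k _; rewrite mxE. Qed.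

Lemma tensmxZ (K : comPzRingType) m n p q (a b : K) (A : 'M[K]_(m, n)) (B : 'M[K]_(p, q)) :
  (a *: A) *t (b *: B) = (a * b) *: (A *t B).
Proof. by apply/matrixP => i j; rewrite !mxE mulrACA. Qed.

Section OperatorBasis.
Variable K : fieldType.

(** A basis of the matrix algebra, recorded by a dual family for the trace form
    together with the right cardinality. *)
Definition opbasis m (I : finType) (B : I -> 'M[K]_m) :=
  (exists D : I -> 'M[K]_m, forall i j, \tr (D i *m B j) = (i == j)%:R) /\
  #|I| = (m * m)%N.

Lemma opbasis_free m (I : finType) (B : I -> 'M[K]_m) : opbasis B ->
  forall c, \sum_i c i *: B i = 0 -> forall i, c i = 0.
Proof.
case=> [[D DB] _] c c0 i; have := congr1 (fun X => \tr (D i *m X)) c0.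
rewrite mulmx0 mxtrace0 mulmx_sumr raddf_sum /= (bigD1 i) //= big1 => [|j ji].
  by rewrite -scalemxAr mxtraceZ DB eqxx mulr1 addr0.
by rewrite -scalemxAr mxtraceZ DB eq_sym (negPf ji) mulr0.
Qed.

Lemma opbasis_span m (I : finType) (B : I -> 'M[K]_m) : opbasis B ->
  forall X, exists c, X = \sum_i c i *: B i.
Proof.
move=> bB; apply: free_span; first exact: opbasis_free.
by rewrite dimvf dim_matrix; case: bB.
Qed.

(** The second basis may be twisted by an invertible operator that depends on the
    first index: the dual family is twisted by its inverse, and the twists cancel
    on the diagonal. *)
Lemma opbasis_tens m n (J S : finType) (B : J -> 'M[K]_m) (W : S -> 'M[K]_n)
    (L : J -> 'M[K]_n) :
  opbasis B -> opbasis W -> (forall j, L j \in unitmx) ->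
  opbasis (fun js : J * S => (L js.1 *m W js.2) *t B js.1).
Proof.
move=> [[D DB] cB] [[E EW] cW] Lu; split; last first.
  by rewrite card_prod cB cW mulnACA [(m * n)%N]mulnC.
exists (fun js => (E js.2 *m invmx (L js.1)) *t D js.1) => -[j s] [j' s'] /=.
rewrite tensmx_mul mxtrace_tens DB xpair_eqE.
have [<-|] := eqVneq j j'; last by rewrite mulr0.
by rewrite -mulmxA mulKmx // EW mulr1.
Qed.

End OperatorBasis.

(** A set of invertible operators T_g permutes the basis elements Z (j, s0), and
    for each s other than s0 some T_g rescales the basis by a factor that depends
    only on the second index and differs from 1 at s. *)
Section MonomialCommutant.
Variables (K : fieldType) (M : nat) (J S : finType) (s0 : S).
Variable (Z : J * S -> 'M[K]_M).
Variables (G : Type) (T : G -> 'M[K]_M) (sigma : G -> J -> J) (e : J -> J -> Prop).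
Hypothesis opZ : opbasis Z.
Hypothesis T_unit : forall g, T g \in unitmx.
Hypothesis detect : forall s, s != s0 -> exists g (theta : S -> K),
  theta s != 1 /\ forall js, T g *m Z js = theta js.2 *: (Z js *m T g).
Hypothesis permute : forall g j, T g *m Z (j, s0) = Z (sigma g j, s0) *m T g.
Hypothesis sigma_inj : forall g, injective (sigma g).
Hypothesis e_sym : forall j j', e j j' -> e j' j.
Hypothesis e_trans : forall j j' j'', e j j' -> e j' j'' -> e j j''.
Hypothesis eP : forall j j', e j j' <-> exists g, sigma g j = j'.

Let embed (c : J -> K) : \sum_j c j *: Z (j, s0) =
  \sum_js (if js.2 == s0 then c js.1 else 0) *: Z js.
Proof.
transitivity (\sum_j \sum_s (if s == s0 then c j else 0) *: Z (j, s)); last first.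
  by rewrite pair_bigA; apply: eq_bigr => -[j s].
apply: eq_bigr => j _; rewrite (bigD1 s0) //= eqxx big1 ?addr0 // => s /negPf->.
exact: scale0r.
Qed.

Let Zfree (c : J -> K) : \sum_j c j *: Z (j, s0) = 0 -> forall j, c j = 0.
Proof.
rewrite embed => /(opbasis_free opZ) c0 j.
by have := c0 (j, s0); rewrite /= eqxx.
Qed.

Let T_cancel g (X Y : 'M[K]_M) : X *m T g = Y *m T g -> X = Y.
Proof. by move=> E; rewrite -(mulmxK (T_unit g) X) E mulmxK. Qed.

(** In the expansion of X, the operators of detect kill the coefficients with
    s <> s0; comparing coefficients in X T_g = T_g X then shows that the remaining
    ones are constant along sigma g. *)
Lemma commutant_invariant (X : 'M[K]_M) : (forall g, X *m T g = T g *m X) <->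
  exists2 a : J -> K, X = \sum_j a j *: Z (j, s0) & forall j j', e j j' -> a j = a j'.
Proof.
split=> [XT | [a -> ea] g]; last first.
  rewrite mulmx_suml mulmx_sumr [LHS](reindex_inj (@sigma_inj g)).
  apply: eq_bigr => j _; rewrite -scalemxAr -scalemxAl permute.
  by congr (_ *: _); apply/esym/ea/eP; exists g.
have [a XE] := opbasis_span opZ X.
have a0 j s : s != s0 -> a (j, s) = 0.
  case/detect=> g [th [th1 thZ]].
  suff /(opbasis_free opZ)/(_ (j, s))/eqP : \sum_js (a js * (th js.2 - 1)) *: Z js = 0.
    by rewrite mulf_eq0 subr_eq0 (negPf th1) orbF => /eqP.
  apply: (@T_cancel g); rewrite mul0mx mulmx_suml.
  rewrite (_ : \sum_js _ = T g *m X - X *m T g); first by rewrite XT subrr.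
  rewrite XE mulmx_sumr mulmx_suml -sumrB; apply: eq_bigr => js _.
  by rewrite -scalemxAr thZ -!scalemxAl scalerA -scalerBl mulrBr mulr1.
have X0 : X = \sum_j a (j, s0) *: Z (j, s0).
  rewrite XE (embed (fun j => a (j, s0))); apply: eq_bigr => -[j s] _ /=.
  by have [->|/a0->] := eqVneq.
exists (fun j => a (j, s0)) => // j j' /eP[g <-]; apply/eqP.
suff /Zfree/(_ (sigma g j)) : \sum_k (a (k, s0) - a (invF (@sigma_inj g) k, s0)) *: Z (k, s0) = 0.
  by rewrite invF_f => /eqP; rewrite subr_eq0 eq_sym.
apply: (@T_cancel g); rewrite mul0mx mulmx_suml.
rewrite (_ : \sum_k _ = X *m T g - T g *m X); first by rewrite XT subrr.
rewrite X0 mulmx_sumr mulmx_suml [X in _ = X - _](reindex_inj (@sigma_inj g)).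
rewrite [LHS](reindex_inj (@sigma_inj g)) -sumrB; apply: eq_bigr => k _.
by rewrite -scalemxAr permute -!scalemxAl -scalerBl invF_f.
Qed.

Lemma dim_commutant_orbits (V : {vspace 'M[K]_M}) (I : finType) (f : I -> J) :
  (forall X, X \in V <-> forall g, X *m T g = T g *m X) ->
  complete_reps e f -> \dim V = #|I|.
Proof.
move=> VE [injf surjf]; have [rep repP] := choice surjf.
have rep_e j j' : e j j' -> rep j = rep j'.
  move=> jj'; apply: injf; apply: e_trans (repP j) _.
  by apply: e_trans jj' _; apply: e_sym.
have rep_f i : rep (f i) = i by apply: injf.
(* The orbit sums form a basis of the commutant. *)
pose O i := \sum_(j | rep j == i) Z (j, s0).
have sumO c : \sum_i c i *: O i = \sum_j c (rep j) *: Z (j, s0).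
  rewrite (partition_big rep xpredT) //=; apply: eq_bigr => i _.
  by rewrite scaler_sumr; apply: eq_bigr => j /eqP->.
apply: (@dim_free_param _ _ _ O) => [c|X].
  by rewrite sumO => /Zfree c0 i; rewrite -(rep_f i) c0.
rewrite VE commutant_invariant; split=> [[a -> ea] | [c ->]].
  by exists (a \o f); rewrite sumO; apply: eq_bigr => j _; rewrite /= (ea _ _ (repP j)).
by rewrite sumO; exists (c \o rep) => // j j' /rep_e /= ->.
Qed.

End MonomialCommutant.

(** * Weyl operators and the unitaries that implement SL2 *)

(** X^m - 1 splits and is separable, and finite subgroups of the multiplicative
    group of a field are cyclic. *)
Lemma prim_root_exists (C : numClosedFieldType) m : (0 < m)%N ->
  exists z : C, m.-primitive_root z.
Proof.
move=> m0; have [s sE] := closed_field_poly_normal ('X^m - 1 : {poly C}).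
rewrite (monicP (monicXnsubC 1 m0)) scale1r in sE.
have /hasP[z _ prim_z] : has m.-primitive_root s; last by exists z.
apply: has_prim_root => //.
- by apply/allP => z zs; rewrite /root_of_unity sE root_prod_XsubC.
- by rewrite -separable_prod_XsubC -sE separable_Xn_sub_1 // pnatr_eq0 -lt0n.
- by rewrite -ltnS -(size_prod_XsubC s id) -sE size_XnsubC.
Qed.

Section OrdRing.
Variable n : nat.
Local Notation N := n.+2.
Local Notation A := 'I_N.

Lemma val_natr k : nat_of_ord (k%:R : A) = (k %% N)%N.
Proof. exact: (@val_Zp_nat N isT k). Qed.

Lemma natr_val (x : A) : x%:R = x.
Proof. by apply: ord_inj; rewrite val_natr modn_small. Qed.

End OrdRing.

Section Reduction.
Variable n : nat.
Local Notation N := n.+2.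
Local Notation A := 'I_N.

Lemma intr_ord_eq0 (k : int) : (k%:~R == 0 :> A) = (N %| k)%Z.
Proof.
have nat_case m : (m%:R == 0 :> A) = (N %| m)%N.
  by rewrite -(inj_eq val_inj) /= val_natr.
case: k => m; first by rewrite -pmulrn nat_case.
by rewrite NegzE mulrNz oppr_eq0 rpredN -pmulrn nat_case.
Qed.

Lemma intr_ord_eq (j k : int) : (j%:~R == k%:~R :> A) = (N %| j - k)%Z.
Proof. by rewrite -subr_eq0 -rmorphB /= intr_ord_eq0. Qed.

Definition redv (v : int * int) : A * A := (v.1%:~R, v.2%:~R).
Definition redm (g : mx2 int) : mx2 A := (redv g.1, redv g.2).
Definition liftv (v : A * A) : int * int := ((v.1 : nat)%:Z, (v.2 : nat)%:Z).
Definition liftm (g : mx2 A) : mx2 int := (liftv g.1, liftv g.2).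

Lemma liftvK v : redv (liftv v) = v.
Proof. by case: v => x y; rewrite /redv /= -!pmulrn !natr_val. Qed.

Lemma liftmK g : redm (liftm g) = g.
Proof. by case: g => v w; rewrite /redm !liftvK. Qed.

Lemma redv_eq v w : (redv v = redv w) <-> vcong N v w.
Proof.
rewrite /vcong -!intr_ord_eq.
by split=> [[-> ->]|/andP[/eqP E /eqP F]]; rewrite ?eqxx // /redv E F.
Qed.

Lemma redv_act g v : redv (vact g v) = vact (redm g) (redv v).
Proof. by rewrite /redv /vact /= !rmorphD !rmorphM. Qed.

Lemma redm_mul g h : redm (mul2 g h) = mul2 (redm g) (redm h).
Proof. by rewrite /redm /mul2 /redv /= !rmorphD !rmorphM. Qed.

Lemma det2_redm g : det2 (redm g) = 1 <-> (N %| det2 g - 1)%Z.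
Proof.
rewrite -intr_ord_eq /det2 /= rmorphB !rmorphM /=.
by split=> [->|/eqP].
Qed.

Lemma same_orbit_red (K : Type) (x y : K -> int * int) : same_orbit N x y <->
  exists2 g : mx2 A, det2 g = 1 & forall k, vact g (redv (x k)) = redv (y k).
Proof.
split=> [[g /det2_redm Dg gx] | [g Dg gx]].
  by exists (redm g) => // k; rewrite -redv_act; apply/redv_eq.
exists (liftm g); first by apply/det2_redm; rewrite liftmK.
by move=> k; apply/redv_eq; rewrite redv_act liftmK.
Qed.

End Reduction.

(** The root eta of order 2N, rather than N, is what makes the chirps well defined
    on Z/N for even N. *)
Section Weyl.
Variables (C : numClosedFieldType) (n : nat) (eta : C).
Local Notation N := n.+2.
Local Notation A := 'I_N.
Hypothesis eta_prim : (N * 2).-primitive_root eta.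

Let zeta := eta ^+ 2.
Lemma zeta_prim : N.-primitive_root zeta.
Proof.
have := exp_prim_root eta_prim 2.
by rewrite (gcdn_idPl _) ?dvdn_mull // mulnK.
Qed.

Definition phase (x : A) : C := zeta ^+ x.

Lemma phase_nat k : phase k%:R = zeta ^+ k.
Proof. by rewrite /phase val_natr (prim_expr_mod zeta_prim). Qed.

Lemma phaseD x y : phase (x + y) = phase x * phase y.
Proof. by rewrite -[x]natr_val -[y]natr_val -natrD !phase_nat exprD. Qed.

Lemma phase0 : phase 0 = 1. Proof. exact: expr0. Qed.

Lemma phase_eq1 x : phase x = 1 -> x = 0.
Proof.
move=> /eqP; rewrite /phase -(prim_order_dvd zeta_prim) => /dvdn_leq xN.
by apply/val_inj/eqP; rewrite /= -leqn0 leqNgt; apply/negP => /xN; rewrite leqNgt ltn_ord.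
Qed.

Lemma norm_eta k : `|eta ^+ k| = 1.
Proof.
rewrite normrX; suff -> : `|eta| = 1 by rewrite expr1n.
apply/eqP; rewrite -(@pexpr_eq1 _ _ (N * 2)%N) //.
by rewrite -normrX (prim_expr_order eta_prim) normr1.
Qed.

Lemma norm_phase x : `|phase x| = 1.
Proof. by rewrite /phase /zeta -exprM norm_eta. Qed.

Lemma phase_neq0 x : phase x != 0.
Proof. by rewrite -normr_eq0 norm_phase oner_eq0. Qed.

Lemma phaseN x : phase (- x) = (phase x)^-1.
Proof.
apply: (mulfI (phase_neq0 x)); rewrite mulfV ?phase_neq0 //.
by rewrite -phaseD subrr phase0.
Qed.

Lemma conj_norm1 (z : C) : `|z| = 1 -> z^* = z^-1.
Proof. by move=> z1; rewrite invC_norm z1 expr1n invr1 mul1r. Qed.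

Lemma conj_phase x : (phase x)^* = phase (- x).
Proof. by rewrite conj_norm1 ?norm_phase // phaseN. Qed.

(** Orthogonality of characters: the sum is invariant under multiplication by
    phase k, through the translation of b by 1. *)
Lemma phase_sum k : \sum_(b : A) phase (k * b) = if k == 0 then N%:R else 0.
Proof.
have [->|k0] := eqVneq k 0.
  under eq_bigr do rewrite mul0r phase0.
  by rewrite sumr_const card_ord.
set s := \sum_b _; suff /eqP : (phase k - 1) * s = 0.
  rewrite mulf_eq0 subr_eq0 => /orP[/eqP/phase_eq1 k0'|/eqP //].
  by rewrite k0' eqxx in k0.
rewrite mulrBl mul1r {1}/s mulr_sumr [X in _ - X](reindex_inj (addrI 1)).
rewrite -sumrB big1 // => b _.
by rewrite mulrDr mulr1 phaseD subrr.
Qed.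

Definition W (v : A * A) : 'M[C]_N :=
  \matrix_(i, b) (if i == v.1 + b then phase (v.2 * b) else 0).

Lemma mulmxW m (X : 'M_(m, N)) w i b : (X *m W w) i b = X i (w.1 + b) * phase (w.2 * b).
Proof.
rewrite mxE (bigD1 (w.1 + b)) //= mxE eqxx big1 ?addr0 // => j /negPf jb.
by rewrite mxE jb mulr0.
Qed.

Lemma mulWmx m (X : 'M_(N, m)) v i b :
  (W v *m X) i b = phase (v.2 * (i - v.1)) * X (i - v.1) b.
Proof.
have iE : v.1 + (i - v.1) = i by rewrite addrC subrK.
rewrite mxE (bigD1 (i - v.1)) //= mxE iE eqxx big1 ?addr0 // => j jb.
rewrite mxE ifN ?mul0r //; apply: contraNneq jb => ->.
by rewrite addrC addKr.
Qed.

Lemma mulW v w : W v *m W w = phase (v.2 * w.1) *: W (v + w).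
Proof.
apply/matrixP => i b; rewrite mulmxW !mxE addrA; case: eqP => _; last by rewrite mul0r mulr0.
by rewrite -!phaseD; congr phase; rewrite /=; ring.
Qed.

Lemma W0 : W 0 = 1.
Proof.
by apply/matrixP => i b; rewrite !mxE /= add0r mul0r phase0; case: eqP.
Qed.

Lemma W_inv v : W v *m (phase (v.2 * v.1) *: W (- v)) = 1.
Proof.
rewrite -scalemxAr mulW subrr scalerA -phaseD W0 /= mulrN subrr phase0.
exact: scale1r.
Qed.

Lemma W_unit v : W v \in unitmx.
Proof. by have /mulmx1_unit[] := W_inv v. Qed.

Lemma W_unitary v : W v \is unitarymx.
Proof.
apply/unitarymxP/matrixP => i b; rewrite mulWmx !mxE.
have -> : (b == v.1 + (i - v.1)) = (i == b) by rewrite addrC subrK eq_sym.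
case: eqP => _; last by rewrite rmorph0 mulr0.
by rewrite conj_phase -phaseD subrr phase0.
Qed.

Lemma trace_W v : \tr (W v) = if v == 0 then N%:R else 0.
Proof.
rewrite /mxtrace; under eq_bigr do rewrite mxE -{1}[X in X == _]add0r (inj_eq (addIr _)) eq_sym.
rewrite -[v == 0]/((v.1 == 0) && (v.2 == 0)); case: (v.1 == 0) => /=; last by rewrite big1.
exact: phase_sum.
Qed.

Lemma W_opbasis : opbasis W.
Proof.
split; last by rewrite card_prod card_ord.
exists (fun v => (N%:R^-1 * phase (v.2 * v.1)) *: W (- v)) => v w.
rewrite -scalemxAl mulW scalerA mxtraceZ trace_W addrC subr_eq0 eq_sym.
case: eqP => [->|_]; last by rewrite mulr0.
rewrite -(mulrA _ (phase _) (phase _)) -phaseD /= mulNr subrr phase0 mulr1 mulVf //.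
by rewrite pnatr_eq0.
Qed.

Lemma W_scale_inj z z' v w : z != 0 -> z *: W v = z' *: W w -> v = w /\ z = z'.
Proof.
move=> z0 E.
pose c u := (if u == v then z else 0) - (if u == w then z' else 0).
have pick (y : C) x : \sum_u (if u == x then y else 0) *: W u = y *: W x.
  by rewrite (bigD1 x) //= eqxx big1 ?addr0 // => u /negPf->; rewrite scale0r.
have /(opbasis_free W_opbasis) c0 : \sum_u c u *: W u = 0.
  by under eq_bigr do rewrite scalerBl; rewrite sumrB !pick E subrr.
have := c0 v; rewrite /c eqxx; case: eqP => [<-|_] /eqP.
  by rewrite subr_eq0 => /eqP.
by rewrite subr0 (negPf z0).
Qed.

(** The phases depend on U and v; they are left unspecified because they cancel in
    the commutant. *)
Definition implements (U : 'M[C]_N) (s : A * A -> A * A) :=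
  U \is unitarymx /\
  forall v, exists2 z : C, `|z| = 1 & U *m W v = z *: (W (s v) *m U).

Lemma implements_comp U V s t :
  implements U s -> implements V t -> implements (U *m V) (s \o t).
Proof.
move=> [uU sU] [uV tV]; split=> [|v]; first exact: mul_unitarymx.
have [z z1 zE] := tV v; have [y y1 yE] := sU (t v).
exists (z * y); first by rewrite normrM z1 y1 mulr1.
rewrite -mulmxA zE -scalemxAr [U *m (_ *m _)]mulmxA yE -scalemxAl scalerA.
by rewrite -mulmxA.
Qed.

Lemma implements_W u : implements (W u) id.
Proof.
split=> [|v]; first exact: W_unitary.
exists (phase (u.2 * v.1 - v.2 * u.1)); first exact: norm_phase.
by rewrite !mulW scalerA -phaseD subrK addrC.
Qed.

Definition fourier : 'M[C]_N := (sqrtC N%:R)^-1 *: \matrix_(i, j) phase (i * j).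

Lemma fourier_implements : implements fourier (vact (rot2 A)).
Proof.
split=> [|v].
  apply/unitarymxP/matrixP => i j; rewrite !mxE.
  have Npos : 0 <= N%:R :> C by rewrite ler0n.
  under eq_bigr => k _.
    rewrite !mxE rmorphM /= conj_phase (geC0_conj (_ : 0 <= (sqrtC N%:R)^-1)).
      rewrite mulrACA -invfM -expr2 sqrtCK -phaseD -mulNr -mulrDl; over.
    by rewrite invr_ge0 sqrtC_ge0.
  rewrite -mulr_sumr phase_sum subr_eq0; case: eqP => _; last by rewrite mulr0.
  by rewrite mulVf // pnatr_eq0.
exists (phase (- (v.1 * v.2))); first exact: norm_phase.
apply/matrixP => i b; rewrite mulmxW [RHS]mxE mulWmx !mxE.
rewrite -mulrA -phaseD [in RHS]mulrA -phaseD [RHS]mulrCA -phaseD; congr (_ * phase _).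
by rewrite /=; ring.
Qed.

Definition chirp_phase (t b : nat) : C := eta ^+ (t * (b * (b + N))).

Lemma eta_period k : eta ^+ (N * 2 * k) = 1.
Proof. by rewrite exprM (prim_expr_order eta_prim) expr1n. Qed.

(** For b = k N + r the exponent changes by t (2 N k r + k (k + 1) N^2), a multiple
    of 2 N since k (k + 1) is even. *)
Lemma chirp_phase_mod t b : chirp_phase t (b %% N) = chirp_phase t b.
Proof.
rewrite /chirp_phase [in RHS](divn_eq b N); set k := (b %/ N)%N; set r := (b %% N)%N.
have [l lE] : exists l, (k * k.+1 = l * 2)%N.
  by exists ((k * k.+1) %/ 2)%N; rewrite divnK // dvdn2 oddM /= andbN.
have -> : (t * ((k * N + r) * (k * N + r + N)) =
           t * (r * (r + N)) + N * 2 * (t * (k * r + l * N)))%N.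
  have -> : ((k * N + r) * (k * N + r + N) =
             r * (r + N) + N * 2 * (k * r) + (k * k.+1) * (N * N))%N by ring.
  by rewrite lE; ring.
by rewrite exprD eta_period mulr1.
Qed.

(** The chirp is quadratic, with the bicharacter phase (t a b); hence conjugating a
    translation by a adds the character t a. *)
Lemma chirp_phaseD (t a b : A) :
  chirp_phase t (a + b)%R = chirp_phase t a * (chirp_phase t b * phase (t * a * b)).
Proof.
have -> : nat_of_ord (a + b)%R = ((a + b) %% N)%N by [].
rewrite chirp_phase_mod -[in phase _](natr_val t) -(natr_val a) -(natr_val b).
rewrite -!natrM phase_nat !natr_val -exprM -!exprD; congr (_ ^+ _).
by ring.
Qed.

Definition chirp (t : A) : 'M[C]_N := diag_mx (\row_(b < N) chirp_phase t b).

Lemma chirp_implements (t : A) : implements (chirp t) (vact (shear2 t)).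
Proof.
have norm_chirp b : `|chirp_phase t b| = 1 by exact: norm_eta.
split=> [|v].
  apply/unitarymxP; rewrite /chirp tr_diag_mx map_diag_mx mulmx_diag -diag_const_mx.
  congr diag_mx; apply/rowP => b; rewrite !mxE /= conj_norm1 // mulfV //.
  by rewrite -normr_eq0 norm_chirp oner_eq0.
exists (chirp_phase t v.1) => //.
apply/matrixP => i b; rewrite /chirp mul_mx_diag mul_diag_mx !mxE /= mul1r mul0r addr0.
case: eqP => [->|_]; last by rewrite !(mul0r, mulr0).
by rewrite chirp_phaseD mul1r mulrDl phaseD; ring.
Qed.

(** Implemented matrices are closed under products and contain the quarter turn and
    the shears, so SL2_lift applies to them. *)
Lemma SL2_implemented (g : mx2 A) : det2 g = 1 -> exists U, implements U (vact g).
Proof.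
move=> Dg.
have [h [_ [U Uh]] hg] : exists2 h, det2 h = 1 /\ exists U, implements U (vact (redm n h))
    & forall v, vcong N (vact h v) (vact (liftm g) v).
  apply: SL2_lift => [h k [Dh [U hU]] [Dk [V kV]]||h []//|t|].
  - split; first by rewrite det2_mul Dh Dk mulr1.
    exists (U *m V); have := implements_comp hU kV.
    by congr implements; apply/funext => v; rewrite redm_mul vact_mul.
  - split; first by rewrite /det2 /=; ring.
    exists fourier; have := fourier_implements.
    by congr implements; congr vact; rewrite /redm /rot2 /redv /= mulrN1z.
  - split; first by rewrite /det2 /=; ring.
    by exists (chirp (t%:~R : A)); apply: chirp_implements.
  - by apply/det2_redm; rewrite liftmK.
exists U; move: Uh; congr implements; apply/funext => v.
by rewrite -[v]liftvK -redv_act -[g]liftmK -redv_act; apply/redv_eq.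
Qed.

(** Since W_v W_w is a phase times W_(v + w), conjugation by U acts additively on
    indices, so it is a matrix g, read off from the images of (1, 0) and (0, 1).
    It preserves the commutation phase of W_(0, 1) and W_(1, 0), which says that
    det g = 1. *)
Lemma covariant_implements (U : 'M[C]_N) : U \is unitarymx ->
  (forall v, exists v', exists2 z : C, `|z| = 1 & U *m W v = z *: (W v' *m U)) ->
  exists2 g : mx2 A, det2 g = 1 & implements U (vact g).
Proof.
move=> uU; have unitU := unitarymx_unit uU.
pose Q v v' := exists2 z : C, `|z| = 1 & U *m W v = z *: (W v' *m U).
rewrite -/(forall v, exists v', Q v v') => Qex.
have Qadd v v' w w' : Q v v' -> Q w w' -> Q (v + w) (v' + w').
  move=> [z z1 zE] [y y1 yE].
  exists (phase (v'.2 * w'.1) / phase (v.2 * w.1) * (z * y)).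
    by rewrite !normrM normfV !norm_phase // z1 y1 !(mulr1, divr1).
  apply: (scalerI (phase_neq0 (v.2 * w.1))).
  rewrite scalemxAr -mulW // mulmxA zE -scalemxAl -mulmxA yE -scalemxAr mulmxA mulW //.
  rewrite -scalemxAl !scalerA; congr (_ *: _).
  by field; exact: phase_neq0.
have Q0 : Q 0 0 by exists 1; rewrite ?normr1 // W0 // mulmx1 mul1mx scale1r.
pose sc k (v : A * A) : A * A := (k%:R * v.1, k%:R * v.2).
have Qsc k v v' : Q v v' -> Q (sc k v) (sc k v').
  move=> Qv; elim: k => [|k IHk]; first by rewrite /sc !mul0r.
  have scS u : sc k.+1 u = u + sc k u by rewrite /sc !mulrS !mulrDl !mul1r.
  by rewrite !scS; apply: Qadd.
have [v1 Q1] := Qex (1, 0); have [v2 Q2] := Qex (0, 1).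
exists ((v1.1, v2.1), (v1.2, v2.2)); last first.
  split=> // v; have := Qadd _ _ _ _ (Qsc v.1 _ _ Q1) (Qsc v.2 _ _ Q2).
  have -> : sc v.1 (1, 0) + sc v.2 (0, 1) = v.
    by rewrite /sc /= !natr_val !mulr1 !mulr0; case: (v) => x y; congr pair; rewrite /= ?addr0 ?add0r.
  suff -> : sc v.1 v1 + sc v.2 v2 = vact ((v1.1, v2.1), (v1.2, v2.2)) v by [].
  by rewrite /sc !natr_val /vact /=; congr pair; rewrite /= ![_ * v.1]mulrC ![_ * v.2]mulrC.
have [z z1 zE] := Q1; have [y y1 yE] := Q2.
have nz (x : C) : `|x| = 1 -> x != 0 by move=> x1; rewrite -normr_eq0 x1 oner_eq0.
have comm : W v2 *m W v1 = phase 1 *: (W v1 *m W v2).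
  rewrite -[LHS](mulmxK unitU) -[W v1 *m W v2](mulmxK unitU) scalemxAl; congr (_ *m _).
  apply: (scalerI (nz _ y1)); apply: (scalerI (nz _ z1)).
  have E21 : U *m W (0, 1) *m W (1, 0) = z *: (y *: (W v2 *m W v1 *m U)).
    rewrite yE -scalemxAl -[W v2 *m U *m _]mulmxA zE -scalemxAr mulmxA.
    by rewrite !scalerA [z * y]mulrC.
  have E12 : U *m W (1, 0) *m W (0, 1) = z *: (y *: (W v1 *m W v2 *m U)).
    by rewrite zE -scalemxAl -[W v1 *m U *m _]mulmxA yE -scalemxAr mulmxA.
  rewrite -E21 (scalerA y) [y * _]mulrC -scalerA (scalerA z) [z * _]mulrC -scalerA -E12.
  by rewrite -!mulmxA !mulW // !mulr1 mulr0 phase0 scale1r addrC scalemxAr.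
have := comm; rewrite !mulW // scalerA [v2 + v1]addrC.
case/(W_scale_inj (phase_neq0 _)) => _ E.
have : phase (v2.2 * v1.1 - 1 - v1.2 * v2.1) = 1.
  by rewrite !phaseD // E !phaseN //; field; rewrite !phase_neq0.
move/phase_eq1 => E'; rewrite -[RHS]add0r -E' /det2 /=.
by ring.
Qed.

Lemma implements_scale U s (y : C) : `|y| = 1 -> implements U s -> implements (y *: U) s.
Proof.
move=> y1 [uU sU]; split=> [|v].
  apply/unitarymxP; rewrite linearZ /= map_mxZ -scalemxAr -scalemxAl scalerA.
  rewrite (unitarymxP uU) /= conj_norm1 // mulVf ?scale1r //.
  by rewrite -normr_eq0 y1 oner_eq0.
have [z z1 zE] := sU v; exists z => //.
by rewrite -scalemxAl zE -scalemxAr !scalerA mulrC.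
Qed.

(** The operators U tensor T U, where B and P are families acted on by T U and by U
    with the same phase and the same permutation ac g of the indices.  In the
    applications P j is the product of the Weyl operators whose tensor product is
    B j, so that P_j^-1 tensor B_j is permuted with no phase. *)
Section TensorCommutant.
Variables (J : finType) (m : nat) (B : J -> 'M[C]_m) (P : J -> 'M[C]_N).
Variables (T : 'M[C]_N -> 'M[C]_m) (ac : mx2 A -> J -> J).
Hypothesis m_neq0 : m != 0%N.
Hypothesis opB : opbasis B.
Hypothesis P_unit : forall j, P j \in unitmx.
Hypothesis T_unit : forall U, U \in unitmx -> T U \in unitmx.
Hypothesis T_conj : forall U g, implements U (vact g) -> forall j,
  exists2 z, z != 0 & T U *m B j = z *: (B (ac g j) *m T U) /\
                      U *m P j = z *: (P (ac g j) *m U).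
Hypothesis ac1 : forall j, ac (one2 A) j = j.
Hypothesis acM : forall g h j, ac (mul2 g h) j = ac g (ac h j).

Let e j j' := exists2 g, det2 g = 1 & ac g j = j'.

Let acK g : det2 g = 1 -> cancel (ac g) (ac (adj2 g)).
Proof.
move=> Dg j; rewrite -acM -[RHS]ac1; congr ac.
by rewrite /mul2 /one2 /=; congr pair; congr pair; rewrite -?Dg /det2; ring.
Qed.

Let conj_inv U g j z : implements U (vact g) -> z != 0 ->
  U *m P j = z *: (P (ac g j) *m U) ->
  U *m invmx (P j) = z^-1 *: (invmx (P (ac g j)) *m U).
Proof.
move=> [uU _] z0 E; have := P_unit (ac g j) => Pu.
have : invmx (P (ac g j)) *m (U *m P j) *m invmx (P j) =
       invmx (P (ac g j)) *m (z *: (P (ac g j) *m U)) *m invmx (P j) by rewrite E.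
rewrite mulmxA mulmxK // -scalemxAr mulKmx // -scalemxAl => ->.
by rewrite scalerA mulVf // scale1r.
Qed.

Let G := {Ug : 'M[C]_N * mx2 A | det2 Ug.2 = 1 /\ implements Ug.1 (vact Ug.2)}.
Let Z (js : J * (A * A)) : 'M[C]_(N * m) :=
  (invmx (P js.1) *m W js.2) *t B js.1.

Lemma dim_tensor_commutant (V : {vspace 'M[C]_(N * m)}) (I : finType) (f : I -> J) :
  (forall X, X \in V <-> forall U g, det2 g = 1 -> implements U (vact g) ->
     X *m (U *t T U) = (U *t T U) *m X) ->
  complete_reps e f -> \dim V = #|I|.
Proof.
move=> VE trf; pose TG (Ug : G) := (sval Ug).1 *t T (sval Ug).1.
have W_one u : implements (W u) (vact (one2 A)).
  have := implements_W u; congr implements.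
  by apply/funext => v; rewrite vact1.
have det1 : det2 (one2 A) = 1 by rewrite /det2 /=; ring.
apply: (@dim_commutant_orbits _ _ J (A * A)%type (0 : A * A) Z G TG
  (fun Ug => ac (sval Ug).2) e) trf.
- apply: (opbasis_tens opB W_opbasis (L := fun j => invmx (P j))) => j.
  by rewrite unitmx_inv.
- move=> [[U g] [/= Dg gU]]; rewrite /TG /=; have uU := unitarymx_unit gU.1.
  by rewrite tensmx_unit // ?T_unit.
- (* Nondegeneracy of the symplectic form. *)
  move=> s s0.
  have [u u1] : exists u : A * A, phase (u.2 * s.1 - s.2 * u.1) != 1.
    have [s10|s10] := eqVneq s.1 0; last first.
      exists (0, 1); rewrite /= mulr0 subr0 mul1r.
      by apply: contraNneq s10 => /phase_eq1->.
    exists (1, 0); rewrite /= mul0r mulr1 sub0r; apply: contraNneq s0.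
    move=> /phase_eq1/eqP; rewrite oppr_eq0 => /eqP s20.
    by move: s10 s20; case: (s) => x y /= -> ->.
  exists (exist _ (W u, one2 A) (conj det1 (W_one u))).
  exists (fun s' => phase (u.2 * s'.1 - s'.2 * u.1)); split=> // -[j s'].
  have [z z0 [zB zP]] := T_conj (W_one u) j; rewrite ac1 in zB zP.
  have := conj_inv (W_one u) z0 (j := j); rewrite ac1 => /(_ zP) zI.
  have swap : W u *m W s' = phase (u.2 * s'.1 - s'.2 * u.1) *: (W s' *m W u).
    by rewrite !mulW // scalerA -phaseD // subrK addrC.
  rewrite /TG /Z /= !tensmx_mul zB mulmxA zI -scalemxAl tensmxZ mulVf // scale1r.
  rewrite -[invmx _ *m W u *m W s']mulmxA swap -scalemxAr mulmxA.
  by rewrite -[X in _ *t X]scale1r tensmxZ mulr1.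
- move=> [[U g] [/= Dg gU]] j; have [z z0 [zB zP]] := T_conj gU j.
  have zI := conj_inv gU z0 zP.
  rewrite /TG /Z /= !tensmx_mul zB W0 mulmx1 zI mulmx1.
  by rewrite tensmxZ mulVf // scale1r.
- by move=> [[U g] [/= Dg gU]]; apply: can_inj (acK Dg).
- move=> j j' [g Dg <-]; exists (adj2 g); rewrite ?det2_adj //; exact: acK.
- move=> j j' j'' [g Dg <-] [h Dh <-]; exists (mul2 h g); rewrite ?acM //.
  by rewrite det2_mul Dg Dh mulr1.
- move=> j j'; split=> [[g Dg gj] | [[[U g] [/= Dg gU]] gj]]; last by exists g.
  have [U gU] := SL2_implemented Dg.
  by exists (exist _ (U, g) (conj Dg gU)).
- move=> X; rewrite VE; split=> [XC [[U g] [/= Dg gU]] | XC U g Dg gU].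
    exact: XC Dg gU.
  exact: (XC (exist _ (U, g) (conj Dg gU))).
Qed.

End TensorCommutant.

Lemma implements_conj U g v : implements U (vact g) ->
  exists2 z : C, z != 0 & U *m W v = z *: (W (vact g v) *m U).
Proof.
case=> _ /(_ v)[z z1 zE]; exists z => //.
by rewrite -normr_eq0 z1 oner_eq0.
Qed.

Lemma dim_commuting_square (V : {vspace 'M[C]_(N * N)}) k :
  (forall X, X \in V <-> forall U g, det2 g = 1 -> implements U (vact g) ->
     X *m (U *t U) = (U *t U) *m X) ->
  orbit_count unit N k -> \dim V = k.
Proof.
move=> VE [I [f [[injf surjf] <-]]].
apply: (@dim_tensor_commutant (A * A)%type N W W id (@vact A) _ _ _ _ _ _ _ V I
          (fun i => redv n (f i tt))) => //.
- exact: W_opbasis.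
- exact: W_unit.
- move=> U g gU v; have [z z0 zE] := implements_conj v gU.
  by exists z.
- exact: vact1.
- exact: vact_mul.
split=> [i j [g Dg gij] | x].
  by apply/injf/(same_orbit_red n _ _); exists g => // -[].
have [i /(same_orbit_red n _ _)[g Dg gx]] := surjf (fun=> liftv x).
by exists i, g => //; rewrite gx liftvK.
Qed.

Lemma dim_commuting_cube (V : {vspace 'M[C]_(N * (N * N))}) k :
  (forall X, X \in V <-> forall U g, det2 g = 1 -> implements U (vact g) ->
     X *m (U *t (U *t U)) = (U *t (U *t U)) *m X) ->
  orbit_count bool N k -> \dim V = k.
Proof.
move=> VE [I [f [[injf surjf] <-]]].
pose B (vw : A * A * (A * A)) := W vw.2 *t W vw.1.
pose P (vw : A * A * (A * A)) := W vw.1 *m W vw.2.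
pose T (U : 'M[C]_N) := U *t U.
pose ac (g : mx2 A) (vw : A * A * (A * A)) := (vact g vw.1, vact g vw.2).
apply: (@dim_tensor_commutant (A * A * (A * A))%type (N * N) B P T ac _ _ _ _ _ _ _ V I
          (fun i => (redv n (f i true), redv n (f i false)))) => //.
- have := opbasis_tens W_opbasis W_opbasis (L := fun=> 1%:M) (fun=> unitmx1 _ _).
  by congr opbasis; apply/funext => vw; rewrite mul1mx.
- by move=> vw; rewrite unitmx_mul !W_unit.
- by move=> U uU; rewrite tensmx_unit.
- move=> U g gU [v w]; have [z z0 zE] := implements_conj v gU.
  have [y y0 yE] := implements_conj w gU; exists (z * y); first by rewrite mulf_neq0.
  rewrite /B /P /T /ac /= !tensmx_mul zE yE tensmxZ [y * z]mulrC; split=> //.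
  by rewrite mulmxA zE -scalemxAl -[W _ *m U *m _]mulmxA yE -scalemxAr scalerA mulmxA.
- by move=> [v w]; rewrite /ac !vact1.
- by move=> g h [v w]; rewrite /ac !vact_mul.
split=> [i j [g Dg gij] | [v w]].
  have [gv gw] := (congr1 fst gij, congr1 snd gij).
  by apply/injf/(same_orbit_red n _ _); exists g => // -[].
have [i /(same_orbit_red n _ _)[g Dg gx]] := surjf (vpair (liftv v) (liftv w)).
by exists i, g => //; rewrite /ac /= !gx /= !liftvK.
Qed.

End Weyl.

(** * The Clifford group of C[Z/N] *)

Section CliffordAction.
Variables (R : realType) (n : nat) (eta : R[i]).
Local Notation N := n.+2.
Local Notation A := 'I_N.
Hypothesis eta_prim : (N * 2).-primitive_root eta.
Local Notation W := (W (n := n) eta).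
Local Notation phase := (phase (n := n) eta).
Local Notation implements := (@implements _ n eta).

Lemma unitChar_phase (k : A) : @unitChar R N (fun b : A => phase (k * b)).
Proof.
split=> [b|b c]; first exact: norm_phase.
by rewrite mulrDr phaseD.
Qed.

(** A character is determined by its value at 1, an N-th root of unity. *)
Lemma unitCharP (chi : A -> R[i]) : @unitChar R N chi ->
  exists k : A, chi = fun b : A => phase (k * b).
Proof.
case=> chi1 chiD.
have chi0 : chi 0 = 1.
  have nz : chi 0 != 0 by rewrite -normr_eq0 chi1 oner_eq0.
  by apply: (mulfI nz); rewrite -chiD addr0 mulr1.
have chi_nat b : chi b%:R = chi 1 ^+ b.
  by elim: b => [|b IHb]; rewrite ?expr0 // mulrS chiD IHb exprS.
have chi1N : chi 1 ^+ N = 1.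
  rewrite -chi_nat -chi0; congr chi; apply: ord_inj.
  by rewrite val_natr modnn.
have [k kE] := prim_rootP (zeta_prim eta_prim) chi1N.
exists k; apply/funext => b.
by rewrite -[b in LHS]natr_val chi_nat kE -exprM -(phase_nat eta_prim) natrM !natr_val.
Qed.

Lemma heisenbergP M : @heisenberg R N M <-> exists2 z, `|z| = 1 & exists v, M = z *: W v.
Proof.
split=> [[z [a [chi [z1 /unitCharP[k ->] ->]]]] | [z z1 [v ->]]].
  by exists z => //; exists (a, k).
by exists z, v.1, (fun b : A => phase (v.2 * b)); split=> //; apply: unitChar_phase.
Qed.

(** Surjectivity of conjugation onto the Heisenberg group uses the inverse of g. *)
Lemma implements_normalizer U (g : mx2 A) : det2 g = 1 -> implements U (vact g) ->
  @cliffordNormalizer R N U.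
Proof.
move=> Dg [uU sU]; have unitU := unitarymx_unit uU.
have conjW v : exists2 z, `|z| = 1 & U *m W v *m invmx U = z *: W (vact g v).
  by have [z z1 zE] := sU v; exists z; rewrite // zE -scalemxAl mulmxK.
split=> //; apply/seteqP; split=> M.
  case=> h /heisenbergP[y y1 [v ->]] <-; have [z z1 zE] := conjW v.
  apply/heisenbergP; exists (y * z); first by rewrite normrM y1 z1 mulr1.
  by exists (vact g v); rewrite -scalemxAr -scalemxAl zE scalerA.
case/heisenbergP=> y y1 [v ->].
have [z z1 zE] := conjW (vact (adj2 g) v).
have gv : vact g (vact (adj2 g) v) = v by rewrite vact_Kadj Dg !mul1r; case: (v).
exists ((y / z) *: W (vact (adj2 g) v)).
  by apply/heisenbergP; exists (y / z); [rewrite normf_div y1 z1 divr1 | exists (vact (adj2 g) v)].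
rewrite -scalemxAr -scalemxAl zE gv scalerA divfK //.
by rewrite -normr_eq0 z1 oner_eq0.
Qed.

Lemma normalizer_implements U : @cliffordNormalizer R N U ->
  exists2 g : mx2 A, det2 g = 1 & implements U (vact g).
Proof.
case=> uU hU; apply: (covariant_implements eta_prim uU) => v.
have /heisenbergP[z z1 [v' zE]] : @heisenberg R N (U *m W v *m invmx U).
  rewrite -hU; exists (W v) => //; apply/heisenbergP; exists 1; rewrite ?normr1 //.
  by exists v; rewrite scale1r.
exists v', z => //; rewrite scalemxAl -[RHS]/((z *: W v') *m U) -zE.
by rewrite mulmxKV // unitarymx_unit.
Qed.

Lemma commutes_with_CliffordP t X : @commutes_with_Clifford R N t X <->
  forall (U : 'M[R[i]]_N) (g : mx2 A), det2 g = 1 -> implements U (vact g) ->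
    X *m ntensmx U t = ntensmx U t *m X.
Proof.
split=> [XC U g Dg gU | XC _ [U cU <-] _ [z z1 <-]].
  apply: (XC (@phaseClass R N U)); first by exists U => //; apply: implements_normalizer gU.
  by exists 1; [exact: normr1 | exact: scale1r].
have [g Dg gU] := normalizer_implements cU.
exact/(XC _ _ Dg)/implements_scale.
Qed.

End CliffordAction.

Lemma dimCommutant2_orbits (R : realType) n k :
  orbit_count unit n.+2 k -> dimCommutant R 2 n.+2 = k.
Proof.
have [eta eta_prim] := prim_root_exists R[i] (isT : 0 < n.+2 * 2)%N.
apply: (dim_commuting_square eta_prim) => X.
exact: (iff_trans (@mem_commutant R n.+2 2 X)
  (@commutes_with_CliffordP R n eta eta_prim 2 X)).
Qed.

Lemma dimCommutant3_orbits (R : realType) n k :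
  orbit_count bool n.+2 k -> dimCommutant R 3 n.+2 = k.
Proof.
have [eta eta_prim] := prim_root_exists R[i] (isT : 0 < n.+2 * 2)%N.
apply: (dim_commuting_cube eta_prim) => X.
exact: (iff_trans (@mem_commutant R n.+2 3 X)
  (@commutes_with_CliffordP R n eta eta_prim 3 X)).
Qed.

(** The ring Z/N used above has N > 1; for N = 1 all operators are scalars. *)
Lemma dim_commutant_trivial (R : realType) t : ((1 ^ t) = 1)%N -> dimCommutant R t 1 = 1%N.
Proof.
move=> t1; rewrite /dimCommutant.
have -> : commutant R 1 t = fullv.
  apply/vspaceP => X; rewrite memvf; apply/mem_commutant => g _ U _.
  have scalar (Y : 'M[R[i]]_(1 ^ t)) : exists a, Y = a%:M.
    by move: Y; rewrite t1 => Y; exists (Y 0 0); apply: mx11_scalar.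
  have [a ->] := scalar X; have [b ->] := scalar (ntensmx U t).
  exact: scalar_mxC.
by rewrite dimvf dim_matrix t1.
Qed.

Local Close Scope ring_scope.

Theorem mainTheorem13 (R : realType) :
  (forall N : nat, 0 < N -> dimCommutant R 2 N = size (divisors N)) /\
  (forall p r : nat, prime p -> 0 < r ->
     dimCommutant R 3 (p ^ r) = p ^ r.-1 * (r.+1 * p + r)) /\
  (forall N : nat, 0 < N ->
     dimCommutant R 3 N =
       \prod_(p <- primes N)
          (p ^ (logn p N).-1 * ((logn p N).+1 * p + logn p N))) /\
  [/\ dimCommutant R 3 2 = 5, dimCommutant R 3 4 = 16,
      dimCommutant R 3 8 = 44 & dimCommutant R 3 9 = 33].
Proof.
have d3 N : 0 < N -> dimCommutant R 3 N =
    \prod_(p <- primes N) (p ^ (logn p N).-1 * ((logn p N).+1 * p + logn p N)).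
  case: N => [|[|n]] // N0; last exact: dimCommutant3_orbits (orbit_count_pairs N0).
  by rewrite dim_commutant_trivial // big_nil.
have d3p p r : prime p -> 0 < r ->
    dimCommutant R 3 (p ^ r) = p ^ r.-1 * (r.+1 * p + r).
  move=> p_pr r0; rewrite d3 ?expn_gt0 ?prime_gt0 // primesX // primes_prime //.
  by rewrite big_seq1 pfactorK.
have d2 N : 0 < N -> dimCommutant R 2 N = size (divisors N).
  case: N => [|[|n]] // N0; last exact: dimCommutant2_orbits (orbit_count_vectors N0).
  by rewrite dim_commutant_trivial.
do 4!split=> //.
- exact: (d3p 2 1 isT isT).
- exact: (d3p 2 2 isT isT).
- exact: (d3p 2 3 isT isT).
- exact: (d3p 3 2 isT isT).
Qed.
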